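(* Let $a,b$ be positive real numbers and $z\in\mathbb{C}$ with $|z|\le 1$. Then $$\gamma_{a,b}(z)=\int_0^1\int_0^1\frac{(xy)^{b-1}(1-x)}{(1-zx^ay^a)(-\log xy)}\,dx\,dy=\int_0^1\frac{x^{b-1}(1-x)}{1-zx^a}\left(\frac{1}{1-x}+\frac{1}{\log x}\right)dx .$$ Moreover, these integrals converge for all $z\in\mathbb{C}\setminus(1,+\infty)$ and give the analytic continuation of $\gamma_{a,b}(z)$ to $z\in\mathbb{C}\setminus[1,+\infty)$.
   Context: For positive reals $a,b$ and $|z|\le 1$, the generalized-Euler-constant function is $\gamma_{a,b}(z)=\sum_{n=0}^{\infty}\left(\frac{1}{an+b}-\log\frac{an+b+1}{an+b}\right)z^n$. *)

(* Defs.v *)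
(* The complex numbers are [R[i]] for [R : realType]; only the alias [R[i]^o]
   carries the topology of the norm. *)
From mathcomp Require Import all_boot all_order all_algebra.
From mathcomp Require Import all_classical all_reals all_analysis.
From mathcomp Require Import complex.

Set Implicit Arguments.
Unset Strict Implicit.
Unset Printing Implicit Defensive.

Import Order.TTheory GRing.Theory Num.Theory.
Import numFieldNormedType.Exports.

Local Open Scope classical_set_scope.
Local Open Scope ring_scope.
Local Open Scope complex_scope.

(* The library only integrates real-valued and extended-real-valued functions:
   a complex-valued function is integrated componentwise. Integrability is
   Lebesgue integrability, i.e. absolute convergence. *)
Definition integrableC d (T : measurableType d) (R : realType)
    (mu : {measure set T -> \bar R}) (D : set T) (f : T -> R[i]) : Prop :=
  mu.-integrable D (EFin \o (fun t => complex.Re (f t))) /\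
  mu.-integrable D (EFin \o (fun t => complex.Im (f t))).

Definition integralC d (T : measurableType d) (R : realType)
    (mu : {measure set T -> \bar R}) (D : set T) (f : T -> R[i]) : R[i] :=
  (\int[mu]_(t in D) complex.Re (f t)) +i* (\int[mu]_(t in D) complex.Im (f t)).

(* Open intervals keep the endpoints, where the integrands below would take the
   junk values of [^-1], [ln] and [powR], out of the domain. *)
Definition integrable01 (R : realType) (f : R -> R[i]) : Prop :=
  integrableC (@lebesgue_measure R) `]0, 1[ f.

Definition integral01 (R : realType) (f : R -> R[i]) : R[i] :=
  integralC (@lebesgue_measure R) `]0, 1[ f.

(* Absolute convergence over the unit square, together with the convergence of
   every inner integral; by Fubini's theorem the outer integral then converges
   as well, and the iterated integral is the integral over the square. *)
Definition integrable0101 (R : realType) (f : R -> R -> R[i]) : Prop :=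
  integrableC (@lebesgue_measure R \x @lebesgue_measure R)%E
    (`]0, 1[ `*` `]0, 1[) (fun p => f p.1 p.2) /\
  (forall y : R, 0 < y < 1 -> integrable01 (fun x => f x y)).

Definition integral0101 (R : realType) (f : R -> R -> R[i]) : R[i] :=
  integral01 (fun y => integral01 (fun x => f x y)).

Definition analytic_at (R : realType) (f : R[i]^o -> R[i]^o) (z0 : R[i]^o) :
    Prop :=
  exists c : nat -> R[i]^o, \forall z \near z0,
    series (fun n => c n * (z - z0) ^+ n) @ \oo --> f z.

(* [f] on [B] is the analytic continuation of [g] on [A]. As [A] is open and
   nonempty and [B] is connected, [f] is unique on [B]. *)
Definition analytic_continuation (R : realType) (A : set R[i]^o)
    (g : R[i]^o -> R[i]^o) (B : set R[i]^o) (f : R[i]^o -> R[i]^o) : Prop :=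
  [/\ open A /\ A !=set0, open B /\ connected B, A `<=` B,
      (forall z, B z -> analytic_at f z) & (forall z, A z -> f z = g z)].

Definition gamma_term (R : realType) (a b : R) (z : R[i]^o) (n : nat) :
    R[i]^o :=
  ((a * n%:R + b)^-1 - ln ((a * n%:R + b + 1) / (a * n%:R + b)))%:C * z ^+ n.

(* The sum of the series; meaningful for [`|z| <= 1]. *)
Definition gamma_ab (R : realType) (a b : R) (z : R[i]^o) : R[i]^o :=
  limn (series (gamma_term a b z)).

Definition double_integrand (R : realType) (a b : R) (z : R[i]^o) (x y : R) :
    R[i]^o :=
  ((x * y) `^ (b - 1) * (1 - x))%:C /
  ((1 - z * (x `^ a * y `^ a)%:C) * (- ln (x * y))%:C).

Definition single_integrand (R : realType) (a b : R) (z : R[i]^o) (x : R) :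
    R[i]^o :=
  (x `^ (b - 1) * (1 - x))%:C / (1 - z * (x `^ a)%:C) *
  ((1 - x)^-1 + (ln x)^-1)%:C.

(* Main.v *)
(* Write k(t) = (t - 1 - ln t) / (- ln t). Scaling Lebesgue measure and Tonelli
   give, for every g >= 0,
     int int g(xy) (1 - x) dx dy = int g(t) (t - 1 - ln t) dt,
   since the integral of (1 - x) / x over [t, 1] is t - 1 - ln t; applied to
   g(t) = t^(b-1) / ((1 - z t^a) (- ln t)), this turns the double integral into
   the single one, which is the integral of t^(b-1) k(t) / (1 - z t^a).
   As 0 <= k <= 1 and k(t) <= (1 + 1/a) (1 - t^a), while 1 - w <= c |1 - zw| on
   [0, 1] when z is not in (1, oo), that integrand is at most a constant times
   t^(b-1), even at z = 1.
   Both the power series at 0 on the closed disc and the Taylor series at a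
   point z0 off [1, oo) come from integrating
     1 / (1 - zw) = \sum_(n < N) w^n (z - z0)^n / (1 - z0 w)^(n+1) + remainder,
   with w = t^a, where the remainder ((z - z0) w / (1 - z0 w))^N / (1 - zw) has
   an integral tending to 0. The coefficients at z0 = 0 are the moments
   int t^(s-1) k(t) dt = 1/s - ln((s + 1) / s), obtained from
   (1 - t) / (- ln t) = int_0^1 t^u du by Tonelli. *)
Require Import Defs.
From mathcomp Require Import all_boot all_order all_algebra.
From mathcomp Require Import all_classical all_reals all_analysis.
From mathcomp Require Import complex measurable_realfun ring lra.
Import Order.TTheory GRing.Theory Num.Theory.
Import numFieldNormedType.Exports.
Local Open Scope classical_set_scope.
Local Open Scope ring_scope.
Local Open Scope complex_scope.

(** * Real integrals *)

Section scaling_and_FTC.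
Context {R : realType}.
Notation mu := (@lebesgue_measure R).

(* [x^-1 = x * (x^2)^-1] also holds for the junk value [0^-1 = 0]. *)
Lemma measurable_funV d (T : measurableType d) (D : set T) (f : T -> R) :
  measurable_fun D f -> measurable_fun D (fun x => (f x)^-1).
Proof.
move=> mf; have -> : (fun x => (f x)^-1) =
    (fun x => f x * (@powR R ^~ (-1)) (f x ^+ 2)).
  apply/funext => x; rewrite /= powR_inv1 ?sqr_ge0// expr2 invfM.
  by have [->|f0] := eqVneq (f x) 0; rewrite ?mul0r ?invr0// mulrA mulfV ?mul1r.
apply: measurable_funM => //.
apply: (@measurableT_comp _ _ _ _ _ _ (@powR R ^~ (-1))).
  exact: measurable_powR.
exact: measurable_funX.
Qed.

Let measurable_scale c :
  measurable_fun [set: measurableTypeR R] ( *%R c : _ -> measurableTypeR R).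
Proof. exact: mulrl_measurable. Qed.

(* The canonical instance on [pushforward] takes the measurability of the map as
   an argument, which unification cannot find: hence the explicit projection. *)
Let scaled_measure (c : R) (c0 : 0 <= c) :
    {measure set (measurableTypeR R) -> \bar R} :=
  mscale (NngNum c0)
    (measure_function_pushforward__canonical__measure_function_Measure mu
      (measurable_scale c)).

(** By uniqueness of Lebesgue measure it suffices to compare half-open intervals: ]x, y] pulls back
    to ]x/c, y/c], and the factor [c] restores the length. *)
Lemma lebesgue_measure_scale (c : R) (c0 : 0 < c)
    (A : set (measurableTypeR R)) : measurable A ->
  mu A = scaled_measure c (ltW c0) A.
Proof.
move=> mA.
apply: lebesgue_measure_unique => // X [[x y] xy <-].
rewrite /scaled_measure/= /mscale /= /pushforward.
have -> : *%R c @^-1` `]x, y]%classic = `](x / c), (y / c)]%classic.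
  by apply/seteqP; split=> t /=;
    rewrite !in_itv/= ltr_pdivrMr// ler_pdivlMr// mulrC.
rewrite !lebesgue_measure_itv/= !lte_fin ltr_pM2r ?invr_gt0//.
case: ifP => _; last by rewrite mule0.
by rewrite -!EFinD -EFinM -mulrBl mulrCA mulfV ?gt_eqF// mulr1.
Qed.

(** The substitution t = c y: on the right the measure is replaced by [c] times its pushforward
    under multiplication by [c], and ]0, c[ pulls back to ]0, 1[. *)
Lemma ge0_integral_scale (c : R) (c0 : 0 < c) (g : R -> R) :
  measurable_fun setT g ->
  (forall x, 0 <= g x) ->
  (\int[mu]_(y in `]0%R, 1%R[) (g (c * y)%R)%:E =
   (c^-1)%:E * \int[mu]_(t in `]0%R, c[) (g t)%:E)%E.
Proof.
move=> mg g0.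
have mE : measurable_fun setT (fun t => (g t)%:E) by exact/measurable_EFinP.
rewrite [in RHS](eq_measure_integral (scaled_measure c (ltW c0))); last first.
  by move=> A mA _; exact: lebesgue_measure_scale.
rewrite ge0_integral_mscale//=; last 2 first.
- exact: measurable_funTS.
- by move=> x _; rewrite lee_fin.
rewrite muleA -EFinM mulVf ?gt_eqF// mul1e.
rewrite ge0_integral_pushforward//=; last 2 first.
- exact: measurable_funTS.
- by move=> x _; rewrite lee_fin.
suff -> : *%R c @^-1` `]0, c[ = `]0, 1[%classic by [].
apply/seteqP; split=> t /=; rewrite !in_itv/= pmulr_rgt0//.
  by rewrite -{2}(mulr1 c) ltr_pM2l.
by rewrite -{2}(mulr1 c) ltr_pM2l.
Qed.

(** The hypotheses reach the closed interval, so that the one-sided limits of [F] are its values;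
    the endpoints themselves do not affect the integral. *)
Lemma integral_itvoo_FTC (f F : R -> R) (x y : R) : x < y ->
  {in `[x, y], forall t : R, is_derive t 1 F (f t)} ->
  {in `[x, y], continuous f} ->
  (\int[mu]_(t in `]x, y[) (f t)%:E = (F y - F x)%:E)%E.
Proof.
move=> xy dF cf.
have cf' : {within `[x, y], continuous f}.
  by apply: continuous_in_subspaceT => t /set_mem/=; exact: cf.
have cF (t : R) : t \in `[x, y] -> {for t, continuous F}.
  move=> ?; apply: differentiable_continuous.
  by apply/derivable1_diffP; have [] := dF t.
rewrite -(@integral_itv_bndoo _ _ _ _ true false).
  rewrite (@continuous_FTC2 _ f F)//.
  - split.
    + move=> t; rewrite in_itv/= => /andP[xt ty].
      by have [] := dF t; rewrite ?in_itv/= ?(ltW xt) ?(ltW ty).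
    + by apply: cvg_at_right_filter; apply: cF; rewrite in_itv/= lexx ltW.
    + by apply: cvg_at_left_filter; apply: cF; rewrite in_itv/= lexx ltW.
  - move=> t; rewrite in_itv/= => /andP[xt ty].
    by rewrite derive1E; have [] := dF t; rewrite ?in_itv/= ?(ltW xt) ?(ltW ty).
apply/measurable_EFinP; apply: (@measurable_funS _ _ _ _ `[x, y]%classic) => //.
  exact: subset_itv_oo_cc.
exact: subspace_continuous_measurable_fun.
Qed.

End scaling_and_FTC.

(** * Tonelli on the unit square and explicit integrals on (0, 1) *)

Section tonelli.
Context {R : realType}.
Notation mu := (@lebesgue_measure R).

(** Nonnegativity is asked on the product [D1 x D2] alone: Tonelli on the whole spaces is applied to
    the extension [g] of [f] by zero. *)
Lemma ge0_tonelli_on d1 d2 (T1 : measurableType d1) (T2 : measurableType d2)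
    (m1 : {sigma_finite_measure set T1 -> \bar R})
    (m2 : {sigma_finite_measure set T2 -> \bar R})
    (D1 : set T1) (D2 : set T2) (f : T1 * T2 -> \bar R) :
  measurable D1 -> measurable D2 -> measurable_fun setT f ->
  (forall p, (D1 `*` D2) p -> 0 <= f p)%E ->
  (\int[m1 \x m2]_(p in D1 `*` D2) f p =
     \int[m1]_(x in D1) \int[m2]_(y in D2) f (x, y) /\
   \int[m1]_(x in D1) \int[m2]_(y in D2) f (x, y) =
     \int[m2]_(y in D2) \int[m1]_(x in D1) f (x, y))%E.
Proof.
move=> mD1 mD2 mf f0.
set g := f \_ (D1 `*` D2).
have mg : measurable_fun setT g.
  apply/(measurable_restrictT f).
    exact: measurableX.
  exact: measurable_funTS.
have g0 p : (0 <= g p)%E by rewrite /g; apply: erestrict_ge0.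
have -> : (\int[m1]_(x in D1) \int[m2]_(y in D2) f (x, y) =
    \int[m1]_x \int[m2]_y g (x, y))%E.
  rewrite integral_mkcond; apply: eq_integral => x _.
  rewrite patchE; case: ifPn => xD.
    rewrite integral_mkcond; apply: eq_integral => y _.
    by rewrite /g !patchE in_setX/= xD.
  rewrite integral0_eq// => y _.
  by rewrite /g patchE in_setX/= (negbTE xD).
have -> : (\int[m2]_(y in D2) \int[m1]_(x in D1) f (x, y) =
    \int[m2]_y \int[m1]_x g (x, y))%E.
  rewrite integral_mkcond; apply: eq_integral => y _.
  rewrite patchE; case: ifPn => yD.
    rewrite integral_mkcond; apply: eq_integral => x _.
    by rewrite /g !patchE in_setX/= yD andbT.
  rewrite integral0_eq// => x _.
  by rewrite /g patchE in_setX/= (negbTE yD) andbF.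
split; last exact: fubini_tonelli.
by rewrite integral_mkcond fubini_tonelli1.
Qed.

Lemma measurable01 : @measurable _ (measurableTypeR R) `]0, 1[%classic.
Proof. exact: measurable_itv. Qed.

Lemma in01 (x : R) : x \in (`]0, 1[%classic : set R) -> 0 < x < 1.
Proof. by move=> /set_mem/=; rewrite in_itv. Qed.

Lemma integral_onem_div (t : R) : 0 < t < 1 ->
  (\int[mu]_(x in `]t, 1%R[) ((1 - x) / x)%:E = (t - 1 - ln t)%:E)%E.
Proof.
move=> /andP[t0 t1].
rewrite (@integral_itvoo_FTC _ _ (fun x => ln x - x))//; last 2 first.
- move=> x; rewrite in_itv/= => /andP[tx x1].
  have x0 : 0 < x by exact: lt_le_trans tx.
  have := is_derive1_ln x0 => ?.
  apply: is_derive_eq.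
  by rewrite mulrBl mulfV ?gt_eqF// mul1r.
- move=> x; rewrite in_itv/= => /andP[tx x1].
  have x0 : 0 < x by exact: lt_le_trans tx.
  apply: cvgM; first by apply: cvgB; [exact: cvg_cst|exact: cvg_id].
  by apply: cvgV; [rewrite gt_eqF|exact: cvg_id].
by rewrite ln1; congr EFin; ring.
Qed.

(** The integrand is t^u; as an exponential it is visibly measurable in (t, u) jointly, which
    [integral_powR_log] relies on. *)
Lemma integral_powR_base (t : R) : 0 < t < 1 ->
  (\int[mu]_(u in `]0%R, 1%R[) (expR (u * ln t))%:E = ((1 - t) / - ln t)%:E)%E.
Proof.
move=> t01; have /andP[t0 t1] := t01; have lt0 := ln_lt0 t01.
rewrite (@integral_itvoo_FTC _ _ (fun u => (ln t)^-1 * expR (u * ln t)))//;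
  last 2 first.
- move=> x _.
  apply: is_derive_eq.
  rewrite /GRing.scale/=; field.
  by rewrite lt_eqF.
- move=> x _ .
  apply: continuous_cvg; first exact: continuous_expR.
  by apply: cvgM; [exact: cvg_id|exact: cvg_cst].
rewrite mul0r mul1r expR0 lnK ?posrE//; congr EFin; field.
by rewrite lt_eqF.
Qed.

Lemma integral_inv_shift (s : R) : 0 < s ->
  (\int[mu]_(u in `]0%R, 1%R[) ((s + u)^-1)%:E = (ln ((s + 1) / s))%:E)%E.
Proof.
move=> s0.
have su (u : R) : 0 <= u <= 1 -> 0 < s + u.
  by move=> /andP[? _]; exact: ltr_wpDr.
rewrite (@integral_itvoo_FTC _ _ (fun u => ln (s + u)))//; last 2 first.
- move=> u; rewrite in_itv/= => u01; have := is_derive1_ln (su _ u01) => ?.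
  apply: (@is_derive_eq _ _ _ _ _ _ _ _ (is_derive1_comp _ _)).
  by rewrite /GRing.scale/=; ring.
- move=> u; rewrite in_itv/= => /su ?.
  apply: cvgV; first by rewrite gt_eqF.
  by apply: cvgD; [exact: cvg_cst|exact: cvg_id].
by rewrite addr0 ln_div ?posrE ?addr_gt0.
Qed.

(** For s < 1 the integrand is unbounded at 0, so the antiderivative t^s / s is used on intervals
    ]e_n, 1[ increasing to ]0, 1[, and monotone convergence gives the limit. *)
Lemma integral_powR (s : R) : 0 < s ->
  (\int[mu]_(t in `]0%R, 1%R[) (t `^ (s - 1))%:E = (s^-1)%:E)%E.
Proof.
move=> s0.
(* The shift by 2 keeps [e n] strictly below 1 already at n = 0. *)
pose e n : R := n.+2%:R^-1.
have e01 n : 0 < e n < 1 by rewrite invr_gt0 ltr0n/= invf_lt1 ?ltr0n// ltr1n.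
have mp : measurable_fun setT (fun t : R => (t `^ (s - 1))%:E).
  by apply/measurable_EFinP; exact: measurable_powR.
pose F n := `]e n, 1[%classic : set R.
have -> : `]0, 1[%classic = \bigcup_n F n.
  apply/seteqP; split=> [t/= |t [n _]]; rewrite /F/= !in_itv/=.
    move=> /andP[t0 t1].
    have [n nt] := ltr_add_invr t0.
    exists n => //=; rewrite in_itv/= t1 andbT (le_lt_trans _ nt)//.
    by rewrite add0r lef_pV2 ?posrE ?ltr0n// ler_nat.
  by move=> /andP[+ ->]; rewrite andbT; apply: lt_trans; case/andP: (e01 n).
pose I n := (\int[mu]_(t in F n) (t `^ (s - 1))%:E)%E.
have L1 : I @ \oo --> (\int[mu]_(t in \bigcup_n F n) (t `^ (s - 1))%:E)%E.
  apply: ge0_nondecreasing_set_cvg_integral => //.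
  - move=> m n mn; apply/subsetPset/subset_itvr; rewrite bnd_simp.
    by rewrite lef_pV2 ?posrE ?ltr0n// ler_nat !ltnS.
  - by move=> n; exact: measurable_itv.
  - by move=> n; exact: measurable_funTS.
  - by move=> n x _; rewrite lee_fin powR_ge0.
suff L2 : I @ \oo --> (s^-1)%:E by rewrite -(cvg_lim _ L1)// (cvg_lim _ L2).
have -> : I =
    (fun n => (s^-1 * (1 - e n `^ s))%:E).
  apply/funext => n; rewrite /I; have /andP[? ?] := e01 n.
  rewrite (@integral_itvoo_FTC _ _ (fun t => s^-1 * t `^ s))//; last 2 first.
  - move=> t; rewrite in_itv/= => /andP[et _].
    have t0 : 0 < t by exact: lt_le_trans et.
    have := is_derive1_powR s t0 => ?.
    apply: is_derive_eq.
    by rewrite /GRing.scale/= mulrA mulVf ?mul1r// gt_eqF.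
  - move=> t; rewrite in_itv/= => /andP[et _].
    have t0 : 0 < t by exact: lt_le_trans et.
    apply: differentiable_continuous.
    by apply/derivable1_diffP; have [] := is_derive1_powR (s-1) t0.
  by rewrite powR1; congr EFin; ring.
apply: cvg_EFin; first exact: nearW.
suff : (s^-1 * (1 - e n `^ s)) @[n --> \oo] --> s^-1 * (1 - 0).
  by rewrite subr0 mulr1.
apply: (@cvgM _ _ _ _ (fun=> s^-1) (fun n => 1 - e n `^ s)).
  exact: cvg_cst.
apply: (@cvgB _ _ _ _ _ (fun=> 1 : R) (fun n => e n `^ s)).
  exact: cvg_cst.
have /cvg_at_rightP := powR_cvg0 s0.
apply; split=> [n|].
  by have /andP[] := e01 n.
by have := @cvg_harmonic R; rewrite -cvg_shiftS.
Qed.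

Lemma ge0_tonelli01 (f : R * R -> \bar R) : measurable_fun setT f ->
  (forall x y : R, (0 < x < 1)%R -> (0 < y < 1)%R -> 0 <= f (x, y))%E ->
  (\int[mu \x mu]_(p in `]0%R, 1%R[ `*` `]0%R, 1%R[) f p =
     \int[mu]_(x in `]0%R, 1%R[) \int[mu]_(y in `]0%R, 1%R[) f (x, y) /\
   \int[mu]_(x in `]0%R, 1%R[) \int[mu]_(y in `]0%R, 1%R[) f (x, y) =
     \int[mu]_(y in `]0%R, 1%R[) \int[mu]_(x in `]0%R, 1%R[) f (x, y))%E.
Proof.
move=> mf f0; apply: ge0_tonelli_on.
- exact: measurable_itv.
- exact: measurable_itv.
- exact: mf.
- by move=> [x y] [/=]; rewrite !in_itv/=; exact: f0.
Qed.

(** Tonelli for t^(s-1) t^u on the square: integrating in u first gives the left side, integrating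
    in t first gives the integral of 1 / (s + u). *)
Lemma integral_powR_log (s : R) : 0 < s ->
  (\int[mu]_(t in `]0%R, 1%R[) (t `^ (s - 1) * ((1 - t) / - ln t))%:E =
   (ln ((s + 1) / s))%:E)%E.
Proof.
move=> s0.
pose f (p : R * R) := (p.1 `^ (s - 1) * expR (p.2 * ln p.1))%:E.
have mf : measurable_fun setT f.
  apply/measurable_EFinP; apply: measurable_funM.
    exact: (measurableT_comp (measurable_powR (s - 1)) measurable_fst).
  apply: measurableT_comp => //; apply: measurable_funM.
    exact: measurable_snd.
  apply: (@measurableT_comp _ _ _ _ _ _ (@ln R)); last exact: measurable_fst.
  exact: measurable_ln.
have f0 (x y : R) : 0 < x < 1 -> 0 < y < 1 -> (0 <= f (x, y))%E.
  by move=> _ _; rewrite lee_fin mulr_ge0 ?powR_ge0 ?expR_ge0.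
have [_] := ge0_tonelli01 _ mf f0.
rewrite [X in X = _](_ : _ = \int[mu]_(t in `]0%R, 1%R[)
    (t `^ (s - 1) * ((1 - t) / - ln t))%:E)%E; last first.
  apply: eq_integral => t /in01 t01.
  rewrite /f/=; under eq_integral do rewrite EFinM.
  rewrite ge0_integralZl_EFin ?powR_ge0//.
  - by rewrite integral_powR_base.
  - apply/measurable_EFinP; apply: measurable_funTS.
    by apply: measurableT_comp => //; exact: measurable_funM.
move=> ->; rewrite -integral_inv_shift//.
apply: eq_integral => u /in01 /andP[u0 u1].
rewrite -integral_powR ?addr_gt0//; apply: eq_integral => t /in01 /andP[t0 t1].
have -> : f (t, u) = (t `^ (s - 1) * t `^ u)%:E.
  by rewrite /f/= [t `^ u]/powR (gt_eqF t0).
by rewrite -powRD ?(gt_eqF t0) ?implybT// addrAC.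
Qed.

Lemma ge0_integral_mul_square (g : R -> R) : measurable_fun setT g ->
  (forall x, 0 <= g x) ->
  (\int[mu \x mu]_(p in `]0%R, 1%R[ `*` `]0%R, 1%R[)
     (g (p.1 * p.2) * (1 - p.1))%:E =
   \int[mu]_(t in `]0%R, 1%R[) (g t * (t - 1 - ln t))%:E)%E.
Proof.
move=> mg g0.
have m1 : measurable_fun setT (fst : R * R -> R) by exact: measurable_fst.
have m2 : measurable_fun setT (snd : R * R -> R) by exact: measurable_snd.
pose f (p : R * R) := (g (p.1 * p.2) * (1 - p.1))%:E.
have mf : measurable_fun setT f.
  apply/measurable_EFinP; apply: measurable_funM.
    by apply: measurableT_comp => //; exact: measurable_funM.
  exact: measurable_funB.
have f0 (x y : R) : 0 < x < 1 -> 0 < y < 1 -> (0 <= f (x, y))%E.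
  by move=> /andP[x0 x1] _; rewrite lee_fin mulr_ge0// subr_ge0 ltW.
have [+ _] := ge0_tonelli01 _ mf f0.
rewrite {1}/f => ->.
(* Cutting off to the triangle t < x by a zero value keeps the domain a square, so that Tonelli can
   exchange x and t. *)
pose h (p : R * R) := if p.2 < p.1 then ((1 - p.1) / p.1 * g p.2)%:E else 0%E.
have mh : measurable_fun setT h.
  apply: measurable_fun_ifT => //; first exact: measurable_fun_ltr.
  apply/measurable_EFinP; apply: measurable_funM; last exact: measurableT_comp.
  by apply: measurable_funM; [exact: measurable_funB|exact: measurable_funV].
have h0 (x y : R) : 0 < x < 1 -> 0 < y < 1 -> (0 <= h (x, y))%E.
  move=> /andP[x0 x1] _; rewrite /h; case: ifP => // _.
  by rewrite lee_fin mulr_ge0// divr_ge0 ?subr_ge0 ?ltW//.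
have [_] := ge0_tonelli01 _ mh h0.
have sub1 (x : R) : 0 < x < 1 -> `]0, x[ `<=` (`]0, 1[%classic : set R).
  by move=> /andP[_ x1]; apply: subset_itvl; rewrite bnd_simp ltW.
have sub2 (x : R) : 0 < x < 1 -> `]x, 1[ `<=` (`]0, 1[%classic : set R).
  by move=> /andP[x0 _]; apply: subset_itvr; rewrite bnd_simp ltW.
(* For fixed x, the substitution t = x y carries the inner integral of [f] to ]0, x[, outside of
   which [h] vanishes. *)
rewrite [X in X = _](_ : _ =
    \int[mu]_(x in `]0%R, 1%R[) \int[mu]_(y in `]0%R, 1%R[) f (x, y))%E;
  last first.
  apply: eq_integral => x /in01 x01; have /andP[x0 x1] := x01.
  rewrite /f/=; under [RHS]eq_integral do rewrite EFinM muleC.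
  rewrite ge0_integralZl_EFin//; last 3 first.
  - by move=> u _; rewrite lee_fin.
  - apply/measurable_EFinP; apply: measurable_funTS.
    by apply: measurableT_comp => //; exact: measurable_funM.
  - by rewrite subr_ge0 ltW.
  rewrite ge0_integral_scale// muleA -EFinM.
  rewrite -ge0_integralZl_EFin//; last 3 first.
  - by move=> u _; rewrite lee_fin.
  - by apply/measurable_EFinP; exact: measurable_funTS.
  - by rewrite divr_ge0 ?subr_ge0 ?ltW//.
  rewrite -(setIidr (sub1 _ x01)) integral_mkcondr.
  apply: eq_integral => t /in01 /andP[t0 t1].
  by rewrite patchE /h/= mem_setE in_itv/= t0/=; case: ifP.
move=> ->; apply: eq_integral => t /in01 t01; have /andP[t0 t1] := t01.
rewrite EFinM -integral_onem_div//.
rewrite -ge0_integralZl_EFin//; last 2 first.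
- move=> u; rewrite /= in_itv/= => /andP[tu u1].
  by rewrite lee_fin divr_ge0 ?subr_ge0 ?ltW// (lt_trans t0).
- apply/measurable_EFinP; apply: measurable_funTS.
  by apply: measurable_funM; [exact: measurable_funB|exact: measurable_funV].
rewrite -(setIidr (sub2 _ t01)) integral_mkcondr.
apply: eq_integral => x /in01 /andP[x0 x1].
rewrite patchE /h/= mem_setE in_itv/= x1 andbT; case: ifP => // _.
by rewrite -EFinM mulrC.
Qed.

End tonelli.

(** * Bounds on the logarithmic kernel *)

Section log_kernel.
Context {R : realType}.

(** This is 1 + v <= exp v at v = - a ln t, divided by exp v = t^(-a). *)
Lemma powR_mul1D_le1 (a t : R) : 0 < t -> t `^ a * (1 - a * ln t) <= 1.
Proof.
move=> t0; rewrite /powR gt_eqF//.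
rewrite -ler_pdivlMl ?expR_gt0// mulr1 -expRN.
by have := expR_ge1Dx (- (a * ln t)).
Qed.

(** Put L = - ln t. The first two bounds are 1 - L <= t and t <= 1. The third is the chain (t - 1 +
    L) / L <= L / (1 + L) <= (1 + a) L / (1 + a L) <= (1 + 1/a) (1 - t^a), whose outer steps are t
    (1 + L) <= 1 and t^a (1 + a L) <= 1. *)
Lemma log_kernel_bounds (a t : R) : 0 < a -> 0 < t < 1 ->
  [/\ 0 <= (t - 1 - ln t) / - ln t, (t - 1 - ln t) / - ln t <= 1 &
      (t - 1 - ln t) / - ln t <= (1 + a^-1) * (1 - t `^ a)].
Proof.
move=> a0 t01; have /andP[t0 t1] := t01; have := ln_lt0 t01.
rewrite -oppr_gt0; set L := - ln t => L0.
have lnt : ln t = - L by rewrite /L opprK.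
have tL : 1 - L <= t by rewrite -(@lnK _ t) ?posrE// lnt; exact: expR_ge1Dx.
have tL1 : t * (1 + L) <= 1.
  by have := @powR_mul1D_le1 1 t t0; rewrite powRr1 ?(ltW t0)// mul1r.
have wL : t `^ a * (1 + a * L) <= 1.
  by have := @powR_mul1D_le1 a t t0; rewrite lnt mulrN opprK.
split.
- by rewrite divr_ge0 ?(ltW L0)//; lra.
- by rewrite ler_pdivrMr//; lra.
have aL0 : 0 < 1 + a * L by rewrite addr_gt0// mulr_gt0.
have hw : a * L / (1 + a * L) <= 1 - t `^ a.
  by rewrite ler_pdivrMr//; move: wL; set w := t `^ a; lra.
have ai : 0 < 1 + a^-1 by rewrite addr_gt0// invr_gt0.
apply: (@le_trans _ _ ((1 + a^-1) * (a * L / (1 + a * L)))); last first.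
  by rewrite ler_pM2l.
have -> : (1 + a^-1) * (a * L / (1 + a * L)) = (1 + a) * L / (1 + a * L).
  by field; rewrite !gt_eqF.
apply: (@le_trans _ _ (L / (1 + L))).
  have L1 : 0 < 1 + L by rewrite addr_gt0.
  rewrite ler_pdivrMr// mulrAC ler_pdivlMr//.
  nra.
rewrite ler_pdivrMr ?addr_gt0// mulrAC ler_pdivlMr//.
have : 0 < a * L by exact: mulr_gt0.
by nra.
Qed.

End log_kernel.

(** * Complex estimates and componentwise integrals *)

(** A finite geometric sum of ratio q = (z - z0) w / (1 - z0 w), since 1 - z w = (1 - z0 w) (1 -
    q). *)
Lemma geometric_remainder (F : fieldType) (z z0 w : F) N :
  1 - z0 * w != 0 -> 1 - z * w != 0 ->
  (1 - z * w)^-1 -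
    \sum_(0 <= n < N) w ^+ n / (1 - z0 * w) ^+ n.+1 * (z - z0) ^+ n =
  ((z - z0) * w / (1 - z0 * w)) ^+ N / (1 - z * w).
Proof.
move=> h0 h; elim: N => [|N IH]; first by rewrite big_nil subr0 expr0 div1r.
rewrite big_nat_recr//= opprD addrA IH ![_ ^+ N.+1]exprSr !exprMn !exprVn.
set W := w ^+ N; set Z := (z - z0) ^+ N; set U := (1 - z0 * w) ^+ N.
have U0 : U != 0 by rewrite expf_neq0.
by field; rewrite h0 h U0.
Qed.

(** * The modulus and lower bounds for |1 - z w| *)

Section complex_bounds.
Context {R : realType}.
Implicit Types z : R[i].

Lemma normcR (x : R) : Normc.normc x%:C = `|x|.
Proof. by rewrite /= expr0n/= addr0 sqrtr_sqr. Qed.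

Lemma normc_ge0 z : 0 <= Normc.normc z.
Proof. by case: z => x y; exact: sqrtr_ge0. Qed.

Lemma normcX z n : Normc.normc (z ^+ n) = Normc.normc z ^+ n.
Proof.
elim: n => [|n IH]; first by rewrite !expr0 Normc.normc1.
by rewrite !exprS Normc.normcM IH.
Qed.

Lemma normc_gt0 z : (0 < Normc.normc z) = (z != 0).
Proof.
rewrite lt_neqAle normc_ge0 andbT eq_sym; congr negb.
apply/eqP/eqP => [|->]; [exact: Normc.eq0_normc|exact: Normc.normc0].
Qed.

Lemma abs_Re_le z : `|complex.Re z| <= Normc.normc z.
Proof.
by case: z => x y /=; rewrite -sqrtr_sqr ler_wsqrtr// lerDl sqr_ge0.
Qed.

Lemma abs_Im_le z : `|complex.Im z| <= Normc.normc z.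
Proof.
by case: z => x y /=; rewrite -sqrtr_sqr ler_wsqrtr// lerDr sqr_ge0.
Qed.

Lemma normc_le z : Normc.normc z <= `|complex.Re z| + `|complex.Im z|.
Proof.
case: z => x y /=; rewrite -(@ger0_norm _ (`|x| + `|y|)) ?addr_ge0//.
rewrite -sqrtr_sqr ler_wsqrtr// sqrrD !real_normK ?num_real//.
by rewrite addrAC lerDl mulrn_wge0// mulr_ge0.
Qed.

(** The real part of 1 - z w is 1 - w Re z, which is at least 1 - w. *)
Lemma onemM_Re_le z (w : R) : 0 <= w -> complex.Re z <= 1 ->
  1 - w <= Normc.normc (1 - z * w%:C).
Proof.
move=> w0 z1; apply: le_trans (abs_Re_le _); apply: le_trans (ler_norm _).
by case: z z1 => p q /=; nra.
Qed.

(** Multiplying 1 - z w by the conjugate of z turns z w into the real number |z|^2 w, so the product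
    has imaginary part - Im z. *)
Lemma onemM_Im_le z (w : R) :
  `|complex.Im z| <= Normc.normc z * Normc.normc (1 - z * w%:C).
Proof.
have -> : Normc.normc z = Normc.normc z^*.
  by case: z => p q; rewrite /= sqrrN.
rewrite -Normc.normcM; apply: le_trans (abs_Im_le _).
case: z => p q /=; rewrite -normrN le_eqVlt; apply/orP; left; apply/eqP.
by congr (Num.norm _); ring.
Qed.

(** For real z < 1 the value 1 - z w is affine in w, hence at least the smaller of its endpoint
    values 1 and 1 - z. For other z, [onemM_Im_le] gives the distance |Im z| / |z|. *)
Lemma off_ray_dist z : ~ (exists2 t : R, 1 <= t & z = t%:C) ->
  exists2 d : R, 0 < d &
    forall w : R, 0 <= w <= 1 -> d <= Normc.normc (1 - z * w%:C).
Proof.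
move=> zray; have [im0|im0] := eqVneq (complex.Im z) 0.
  have p1 : complex.Re z < 1.
    rewrite ltNge; apply/negP => p1; apply: zray; exists (complex.Re z) => //.
    by case: z im0 p1 => p q /= ->.
  exists (Num.min 1 (1 - complex.Re z)).
    by rewrite lt_min ltr01 subr_gt0.
  move=> w /andP[w0 w1]; apply: le_trans (abs_Re_le _).
  apply: le_trans (ler_norm _); case: z im0 p1 {zray} => p q /= -> p1.
  rewrite ge_min; have [p0|p0] := leP p 0; apply/orP; [left|right]; nra.
have z0 : z != 0 by apply: contraNneq im0 => ->.
exists (`|complex.Im z| / Normc.normc z).
  by rewrite divr_gt0 ?normr_gt0 ?normc_gt0.
move=> w _; rewrite ler_pdivrMr ?normc_gt0// mulrC.
exact: onemM_Im_le.
Qed.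

(* The factor [1 - w] is what is needed at [z = 1], where [1 - z w] vanishes at
   [w = 1]. *)
Lemma off_open_ray_dist z : ~ (exists2 t : R, 1 < t & z = t%:C) ->
  exists2 c : R, 0 < c &
    forall w : R, 0 <= w <= 1 -> 1 - w <= c * Normc.normc (1 - z * w%:C).
Proof.
move=> zray; have [p1|p1] := leP (complex.Re z) 1.
  by exists 1 => // w /andP[w0 _]; rewrite mul1r; exact: onemM_Re_le.
(* Here Re z > 1, so a point of the closed ray would lie on the open one. Off the closed ray, 1 - w
   <= 1 is at most 1/d times the modulus. *)
have [|d d0 dP] := @off_ray_dist z.
  case=> t _ zt; apply: zray; exists t => //.
  by move: p1; rewrite zt.
exists d^-1; first by rewrite invr_gt0.
move=> w w01; rewrite mulrC ler_pdivlMr//.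
apply: le_trans (dP _ w01).
by case/andP: w01 => w0 w1; rewrite ger_pMl//; lra.
Qed.

End complex_bounds.

(** * Measurability, domination and linearity for componentwise integrals *)

Section complex_integral.
Context {R : realType} {d : measure_display} {T : measurableType d}.
Variables (mu : {measure set T -> \bar R}) (D : set T).
Hypothesis mD : measurable D.
Implicit Types (f g : T -> R[i]) (h : T -> R) (c : R[i]).

Definition measurable_funC f : Prop :=
  measurable_fun D (fun t => complex.Re (f t)) /\
  measurable_fun D (fun t => complex.Im (f t)).

Lemma measurable_funC_cst c : measurable_funC (fun=> c).
Proof. by split; exact: measurable_cst. Qed.

Lemma measurable_funC_real h : measurable_fun D h ->
  measurable_funC (fun t => (h t)%:C).
Proof. by move=> mh; split=> //=; exact: measurable_cst. Qed.

Lemma measurable_funCD f g : measurable_funC f -> measurable_funC g ->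
  measurable_funC (fun t => f t + g t).
Proof.
move=> [rf jf] [rg jg]; split.
  rewrite [X in measurable_fun _ X](_ : _ =
      (fun t => complex.Re (f t) + complex.Re (g t))); last first.
    by apply/funext => t; case: (f t); case: (g t).
  exact: measurable_funD.
rewrite [X in measurable_fun _ X](_ : _ =
    (fun t => complex.Im (f t) + complex.Im (g t))); last first.
  by apply/funext => t; case: (f t); case: (g t).
exact: measurable_funD.
Qed.

Lemma measurable_funCM f g : measurable_funC f -> measurable_funC g ->
  measurable_funC (fun t => f t * g t).
Proof.
move=> [rf jf] [rg jg]; split.
  rewrite [X in measurable_fun _ X](_ : _ = (fun t =>
      complex.Re (f t) * complex.Re (g t) -
      complex.Im (f t) * complex.Im (g t))).
    by apply: measurable_funB; exact: measurable_funM.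
  by apply/funext => t; case: (f t); case: (g t).
rewrite [X in measurable_fun _ X](_ : _ = (fun t =>
    complex.Re (f t) * complex.Im (g t) + complex.Im (f t) * complex.Re (g t))).
  by apply: measurable_funD; exact: measurable_funM.
by apply/funext => t; case: (f t); case: (g t).
Qed.

Lemma measurable_funCV f : measurable_funC f ->
  measurable_funC (fun t => (f t)^-1).
Proof.
move=> [rf jf].
pose n2 t := (complex.Re (f t) ^+ 2 + complex.Im (f t) ^+ 2)^-1.
have mn2 : measurable_fun D n2.
  by apply: measurable_funV; apply: measurable_funD; exact: measurable_funX.
split.
  rewrite [X in measurable_fun _ X](_ : _ = (fun t => complex.Re (f t) * n2 t)).
    exact: measurable_funM.
  by apply/funext => t; rewrite /n2; case: (f t).
rewrite [X in measurable_fun _ X](_ : _ =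
    (fun t => - (complex.Im (f t) * n2 t))).
  by apply: measurable_funN; exact: measurable_funM.
by apply/funext => t; rewrite /n2; case: (f t).
Qed.

Lemma measurable_funCX f n : measurable_funC f ->
  measurable_funC (fun t => f t ^+ n).
Proof.
move=> mf; elim: n => [|n IH]; first exact: measurable_funC_cst.
rewrite (_ : (fun t => f t ^+ n.+1) = (fun t => f t * f t ^+ n)).
  exact: measurable_funCM.
by apply/funext => t; rewrite exprS.
Qed.

Lemma integrableC_le f h : measurable_funC f ->
  mu.-integrable D (EFin \o h) ->
  (forall t, D t -> Normc.normc (f t) <= h t) -> integrableC mu D f.
Proof.
move=> [rf jf] ih fh; split; apply: (le_integrable mD _ _ ih).
- exact/measurable_EFinP.
- move=> t Dt /=; rewrite lee_fin; apply: le_trans (abs_Re_le _) _.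
  exact: le_trans (fh _ Dt) (ler_norm _).
- exact/measurable_EFinP.
- move=> t Dt /=; rewrite lee_fin; apply: le_trans (abs_Im_le _) _.
  exact: le_trans (fh _ Dt) (ler_norm _).
Qed.

(** The factor 2 comes from bounding the real and imaginary parts separately; it is harmless because
    the bound serves to make remainders tend to 0. *)
Lemma normc_integralC_le f h : integrableC mu D f ->
  mu.-integrable D (EFin \o h) ->
  (forall t, D t -> Normc.normc (f t) <= h t) ->
  Normc.normc (integralC mu D f) <= 2 * \int[mu]_(t in D) h t.
Proof.
move=> [rf jf] ih fh; apply: le_trans (normc_le _) _ => /=.
rewrite mulrDl mul1r; apply: lerD;
  apply: le_trans (le_normr_Rintegral _ _) _ => //.
  apply: le_Rintegral => //; first exact: integrable_norm.
  by move=> t Dt; exact: le_trans (abs_Re_le _) (fh _ Dt).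
apply: le_Rintegral => //; first exact: integrable_norm.
by move=> t Dt; exact: le_trans (abs_Im_le _) (fh _ Dt).
Qed.

Lemma eq_integralC f g : (forall t, D t -> f t = g t) ->
  integralC mu D f = integralC mu D g.
Proof.
by move=> fg; rewrite /integralC; congr Complex;
  apply: eq_Rintegral => t /set_mem Dt; rewrite fg.
Qed.

Lemma eq_integrableC f g : (forall t, D t -> f t = g t) ->
  integrableC mu D f -> integrableC mu D g.
Proof.
move=> fg [rf jf]; split.
  by apply: eq_integrable rf => // t /set_mem Dt /=; rewrite fg.
by apply: eq_integrable jf => // t /set_mem Dt /=; rewrite fg.
Qed.

Lemma integrableCD f g : integrableC mu D f -> integrableC mu D g ->
  integrableC mu D (fun t => f t + g t).
Proof.
move=> [rf jf] [rg jg]; split.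
  apply: eq_integrable (integrableD mD rf rg) => // t _ /=.
  by case: (f t); case: (g t).
apply: eq_integrable (integrableD mD jf jg) => // t _ /=.
by case: (f t); case: (g t).
Qed.

Lemma integralCD f g : integrableC mu D f -> integrableC mu D g ->
  integralC mu D (fun t => f t + g t) = integralC mu D f + integralC mu D g.
Proof.
move=> [rf jf] [rg jg]; rewrite /integralC/=; congr Complex.
  rewrite -RintegralD//; apply: eq_Rintegral => t _.
  by case: (f t); case: (g t).
rewrite -RintegralD//; apply: eq_Rintegral => t _.
by case: (f t); case: (g t).
Qed.

Let integrable_lin h1 h2 (x y : R) : mu.-integrable D (EFin \o h1) ->
  mu.-integrable D (EFin \o h2) ->
  mu.-integrable D (EFin \o (fun t => x * h1 t + y * h2 t)).
Proof.
move=> i1 i2.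
have := integrableD mD (integrableZl mD x i1) (integrableZl mD y i2).
by apply: eq_integrable.
Qed.

Let Rintegral_lin h1 h2 (x y : R) : mu.-integrable D (EFin \o h1) ->
  mu.-integrable D (EFin \o h2) ->
  \int[mu]_(t in D) (x * h1 t + y * h2 t) =
  x * \int[mu]_(t in D) h1 t + y * \int[mu]_(t in D) h2 t.
Proof.
move=> i1 i2; rewrite RintegralD//; last 2 first.
- by apply: eq_integrable (integrableZl mD x i1).
- by apply: eq_integrable (integrableZl mD y i2).
by rewrite !RintegralZl.
Qed.

Lemma integrableCZ c f : integrableC mu D f ->
  integrableC mu D (fun t => c * f t).
Proof.
case: c => x y [rf jf]; split.
  apply: eq_integrable (integrable_lin _ _ x (- y) rf jf) => // t _ /=.
  by case: (f t) => p q /=; rewrite mulNr.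
apply: eq_integrable (integrable_lin _ _ x y jf rf) => // t _ /=.
by case: (f t) => p q /=.
Qed.

Lemma integralCZ c f : integrableC mu D f ->
  integralC mu D (fun t => c * f t) = c * integralC mu D f.
Proof.
case: c => x y [rf jf]; rewrite /integralC/=; congr Complex.
  rewrite -mulNr -Rintegral_lin//; apply: eq_Rintegral => t _.
  by case: (f t) => p q /=; rewrite mulNr.
rewrite -Rintegral_lin//; apply: eq_Rintegral => t _.
by case: (f t).
Qed.

Lemma integrableC_sum (F : nat -> T -> R[i]) N :
  (forall n, integrableC mu D (F n)) ->
  integrableC mu D (fun t => \sum_(0 <= n < N) F n t) /\
  integralC mu D (fun t => \sum_(0 <= n < N) F n t) =
    \sum_(0 <= n < N) integralC mu D (F n).
Proof.
move=> iF; elim: N => [|N [IH1 IH2]].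
  under eq_fun do rewrite big_nil.
  rewrite big_nil; split.
    by split; exact: integrable0.
  by rewrite /integralC/= /Rintegral !integral0.
under eq_fun do rewrite big_nat_recr//=.
rewrite big_nat_recr//= -IH2; split; first exact: integrableCD.
by rewrite integralCD.
Qed.

End complex_integral.

(** * Reduction of integrals over the square to one variable *)

Section unit_square.
Context {R : realType}.
Notation mu := (@lebesgue_measure R).
Variable h : R -> R.
Hypothesis mh : measurable_fun setT h.
Hypothesis ih :
  mu.-integrable `]0, 1[ (EFin \o (fun t => h t * (t - 1 - ln t))).

Let sub1ln_ge0 (t : R) : 0 < t < 1 -> 0 <= t - 1 - ln t.
Proof.
move=> /andP[t0 t1]; have : ln (1 + (t - 1)) <= t - 1 by apply: le_ln1Dx; lra.
by rewrite subrKC subr_ge0.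
Qed.

Let q (p : R * R) := h (p.1 * p.2) * (1 - p.1).

Let mq : measurable_fun setT q.
Proof.
have m1 : measurable_fun setT (fst : R * R -> R) by exact: measurable_fst.
have m2 : measurable_fun setT (snd : R * R -> R) by exact: measurable_snd.
apply: measurable_funM; last exact: measurable_funB.
by apply: measurableT_comp => //; exact: measurable_funM.
Qed.

Let mDD : measurable
  (`]0%R, 1%R[ `*` `]0%R, 1%R[ : set (measurableTypeR R * measurableTypeR R)).
Proof. by apply: measurableX; exact: measurable_itv. Qed.

(** Both 1 - x and t - 1 - ln t are nonnegative, so absolute values fall on [h] alone and the
    nonnegative identity applies to |h|. *)
Lemma integrable_mul_square :
  (mu \x mu)%E.-integrable (`]0%R, 1%R[ `*` `]0%R, 1%R[) (EFin \o q).
Proof.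
apply/integrableP; split.
  by apply/measurable_EFinP; apply: measurable_funTS.
move/integrableP : ih => [_]; apply: le_lt_trans.
rewrite le_eqVlt; apply/orP; left; apply/eqP.
transitivity (\int[mu]_(t in `]0%R, 1%R[) (`|h t| * (t - 1 - ln t))%:E)%E.
  rewrite -(@ge0_integral_mul_square _ (fun t => `|h t|))//; last first.
    exact: measurableT_comp.
  apply: eq_integral => -[x y] /set_mem[/=].
  rewrite !in_itv/= => /andP[x0 x1] _.
  by rewrite /q/= normrM (@ger0_norm _ (1 - x))// subr_ge0 ltW.
apply: eq_integral => t /in01 t01.
by rewrite /= normrM (@ger0_norm _ (t - 1 - ln t))// sub1ln_ge0.
Qed.

(** Positive and negative parts pass through the nonnegative factors 1 - x and t - 1 - ln t, so the
    nonnegative identity applies to each part of [h]. *)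
Lemma integral_mul_square :
  (\int[mu \x mu]_(p in `]0%R, 1%R[ `*` `]0%R, 1%R[) (q p)%:E =
   \int[mu]_(t in `]0%R, 1%R[) (h t * (t - 1 - ln t))%:E)%E.
Proof.
rewrite integralE [RHS]integralE; congr (_ - _)%E.
  transitivity (\int[mu]_(t in `]0%R, 1%R[) (h^\+ t * (t - 1 - ln t))%:E)%E.
    rewrite -(@ge0_integral_mul_square _ h^\+)//; last first.
      exact: measurable_funrpos.
    apply: eq_integral => -[x y] /set_mem[/=].
    rewrite !in_itv/= => /andP[x0 x1] _.
    by rewrite /q funeposE /funrpos/= -EFin_max maxr_pMl ?mul0r// subr_ge0 ltW.
  apply: eq_integral => t /in01 t01.
  by rewrite funeposE /funrpos/= -EFin_max maxr_pMl ?mul0r// sub1ln_ge0.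
transitivity (\int[mu]_(t in `]0%R, 1%R[) (h^\- t * (t - 1 - ln t))%:E)%E.
  rewrite -(@ge0_integral_mul_square _ h^\-)//; last exact: measurable_funrneg.
  apply: eq_integral => -[x y] /set_mem[/=].
  rewrite !in_itv/= => /andP[x0 x1] _.
  rewrite /q funenegE /funrneg/= -EFin_max maxr_pMl ?mul0r ?mulNr//.
  by rewrite subr_ge0 ltW.
apply: eq_integral => t /in01 t01.
by rewrite funenegE /funrneg/= -EFin_max maxr_pMl ?mul0r ?mulNr// sub1ln_ge0.
Qed.

(** Fubini for the extension by zero. Integrability of each section makes the inner extended-real
    integral finite, so [fine] loses nothing there. *)
Lemma Rintegral_mul_square :
  (forall y : R, 0 < y < 1 ->
    mu.-integrable `]0, 1[ (EFin \o (fun x => h (x * y) * (1 - x)))) ->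
  \int[mu]_(y in `]0, 1[) (\int[mu]_(x in `]0, 1[) (h (x * y) * (1 - x))) =
  \int[mu]_(t in `]0, 1[) (h t * (t - 1 - ln t)).
Proof.
move=> iq; rewrite /Rintegral; congr fine.
rewrite -integral_mul_square [RHS]integral_mkcond -integral21_prod_meas1;
  last first.
  by apply/(integrable_mkcond _ mDD); exact: integrable_mul_square.
rewrite integral_mkcond; apply: eq_integral => y _.
rewrite /fubini_G patchE; case: ifPn => [/in01 y01|yD].
  rewrite fineK; last first.
    by apply: integrable_fin_num => //; exact: iq.
  rewrite integral_mkcond; apply: eq_integral => x _.
  by rewrite !patchE in_setX/= [y \in _]mem_set ?andbT//=.
rewrite integral0_eq// => x _.
by rewrite patchE in_setX/= (negbTE yD) andbF.
Qed.

End unit_square.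

(** * Series expansions under the integral sign *)

Section complex_series.
Context {R : realType}.

Lemma normc_norm (z : R[i]^o) : `|z| = (Normc.normc z)%:C.
Proof. by case: z. Qed.

(** The epsilons of the topology on [R[i]^o] are positive elements of [R[i]], hence real; this
    brings them down to [R]. *)
Lemma gt0_complexE (e : R[i]) :
  0 < e -> 0 < complex.Re e /\ e = (complex.Re e)%:C.
Proof. by case: e => x y; rewrite ltcE/= => /andP[/eqP -> ->]. Qed.

Lemma cvg_normc_le (u : nat -> R[i]^o) (l : R[i]^o) (e : nat -> R) :
  (forall n, Normc.normc (l - u n) <= e n) -> e n @[n --> \oo] --> 0 ->
  u n @[n --> \oo] --> l.
Proof.
move=> ule e0; apply/cvgrPdist_lt => eps /gt0_complexE[eps0 ->].
near=> n.
rewrite normc_norm ltcR; apply: le_lt_trans (ule n) _.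
apply: le_lt_trans (ler_norm _) _; rewrite -[e n]subr0 distrC.
by near: n; move/cvgrPdist_lt : e0; exact.
Unshelve. all: by end_near. Qed.

(** Partial sums are integrated termwise by linearity, and the error after n terms is at most twice
    the integral of [r n]. *)
Lemma integralC_series d (T : measurableType d) (mu : {measure set T -> \bar R})
    (D : set T) (mD : measurable D) (f : T -> R[i]) (c : nat -> T -> R[i])
    (zeta : R[i]) (r : nat -> T -> R) :
  integrableC mu D f -> (forall n, integrableC mu D (c n)) ->
  (forall n, mu.-integrable D (EFin \o r n)) ->
  (forall n t, D t ->
    Normc.normc (f t - \sum_(0 <= k < n) c k t * zeta ^+ k) <= r n t) ->
  \int[mu]_(t in D) r n t @[n --> \oo] --> 0 ->
  series (fun n => integralC mu D (c n) * zeta ^+ n : R[i]^o) @ \oo -->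
    (integralC mu D f : R[i]^o).
Proof.
move=> fi ci ri fr r0.
apply: (@cvg_normc_le _ _ (fun n => 2 * \int[mu]_(t in D) r n t)); last first.
  rewrite -[X in _ --> X](mulr0 2); apply: cvgM => //; exact: cvg_cst.
move=> n; rewrite /series/=.
have ci' k : integrableC mu D (fun t => zeta ^+ k * c k t).
  exact: integrableCZ.
have [i1 i2] := integrableC_sum _ _ mD (fun k t => zeta ^+ k * c k t) n ci'.
rewrite (eq_bigr (fun k => integralC mu D (fun t => zeta ^+ k * c k t)));
  last first.
  by move=> k _; rewrite integralCZ// mulrC.
rewrite -i2 -mulN1r -integralCZ// -integralCD//; last exact: integrableCZ.
apply: normc_integralC_le => //.
  by apply: integrableCD => //; exact: integrableCZ.
move=> t Dt.
rewrite mulN1r (eq_bigr (fun k => c k t * zeta ^+ k)); first exact: fr.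
by move=> k _; rewrite mulrC.
Qed.

End complex_series.

(** * The single integral and its expansions *)

Section kernel.
Context {R : realType} (a b : R) (a0 : 0 < a) (b0 : 0 < b).
Notation mu := (@lebesgue_measure R).
Notation D := (`]0, 1[%classic : set R).

(** This is t^(b-1) k(t); the ratio k(t) is also 1 - (1 - t) / (- ln t), the form in which its
    moments are computed. *)
Definition log_weight (t : R) : R := t `^ (b - 1) * ((t - 1 - ln t) / - ln t).

Definition kernel_integrand (z : R[i]) (t : R) : R[i] :=
  (log_weight t)%:C * (1 - z * (t `^ a)%:C)^-1.

Lemma integrable_powR (s : R) : 0 < s ->
  mu.-integrable D (EFin \o (fun t => t `^ (s - 1))) /\
  \int[mu]_(t in D) t `^ (s - 1) = s^-1.
Proof.
move=> s0; split; last by rewrite /Rintegral integral_powR.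
apply/integrableP; split.
  by apply/measurable_EFinP; apply: measurable_funTS; exact: measurable_powR.
rewrite (_ : (\int[mu]_(x in D) _)%E = (s^-1)%:E) ?ltry// -integral_powR//.
by apply: eq_integral => t _; rewrite /= ger0_norm ?powR_ge0.
Qed.

Lemma log_weight_ge0 (t : R) : 0 < t < 1 -> 0 <= log_weight t.
Proof.
by move=> /(log_kernel_bounds a _ a0)[? _ _]; rewrite mulr_ge0 ?powR_ge0.
Qed.

Lemma log_weight_le (t : R) : 0 < t < 1 -> log_weight t <= t `^ (b - 1).
Proof.
by move=> /(log_kernel_bounds a _ a0)[_ ? _]; rewrite ler_piMr ?powR_ge0.
Qed.

Lemma log_weight_le_onem (t : R) : 0 < t < 1 ->
  log_weight t <= (1 + a^-1) * t `^ (b - 1) * (1 - t `^ a).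
Proof.
move=> /(log_kernel_bounds a _ a0)[_ _ ?].
by rewrite mulrAC mulrC ler_wpM2l ?powR_ge0.
Qed.

Lemma powR01 (t : R) : 0 < t < 1 -> 0 < t `^ a < 1.
Proof.
move=> t01; have /andP[t0 t1] := t01; rewrite powR_gt0//=.
by rewrite /powR gt_eqF// expR_lt1 pmulr_rlt0// ln_lt0.
Qed.

Lemma measurable_log_weight : measurable_fun setT log_weight.
Proof.
have mln : measurable_fun setT (@ln R) by exact: measurable_ln.
apply: measurable_funM; first exact: measurable_powR.
apply: measurable_funM.
  by apply: measurable_funB => //; exact: measurable_funB.
by apply: measurable_funV; exact: measurable_funN.
Qed.

Lemma measurable_den E (z : R[i]) :
  measurable_funC (R := R) (T := R) E (fun t => 1 - z * (t `^ a)%:C).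
Proof.
rewrite (_ : (fun t => _) = (fun t => 1 + - z * (t `^ a)%:C)); last first.
  by apply/funext => t; rewrite mulNr.
apply: measurable_funCD; first exact: measurable_funC_cst.
apply: measurable_funCM; first exact: measurable_funC_cst.
apply: measurable_funC_real; apply: measurable_funTS; exact: measurable_powR.
Qed.

(** The weight is at most (1 + 1/a) t^(b-1) (1 - t^a), and 1 - t^a <= c |1 - z t^a| cancels the
    denominator, leaving a multiple of t^(b-1). This covers z = 1. *)
Lemma integrable_kernel_integrand (z : R[i]) :
  ~ (exists2 t : R, 1 < t & z = t%:C) -> integrable01 (kernel_integrand z).
Proof.
move=> /off_open_ray_dist[c c0 cP].
have [ip _] := integrable_powR b b0.
have ip' : mu.-integrable D (EFin \o (fun t => c * (1 + a^-1) * t `^ (b - 1))).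
  by apply: eq_integrable (integrableZl measurable01 (c * (1 + a^-1)) ip).
apply: (integrableC_le _ _ measurable01 _ _ _ ip').
  apply: measurable_funCM.
    apply: measurable_funC_real; apply: measurable_funTS.
    exact: measurable_log_weight.
  by apply: measurable_funCV; exact: measurable_den.
move=> t; rewrite /= in_itv/= => t01; have /andP[w0 w1] := powR01 _ t01.
rewrite Normc.normcM Normc.normcV normcR ger0_norm ?log_weight_ge0//.
have cw : 1 - t `^ a <= c * Normc.normc (1 - z * (t `^ a)%:C).
  by apply: cP; rewrite (ltW w0) (ltW w1).
have n0 : 0 < Normc.normc (1 - z * (t `^ a)%:C).
  by rewrite -(pmulr_rgt0 _ c0); apply: lt_le_trans cw; rewrite subr_gt0.
rewrite ler_pdivrMr//; apply: le_trans (log_weight_le_onem _ t01) _.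
rewrite [leRHS](_ : _ = (1 + a^-1) * t `^ (b - 1) *
  (c * Normc.normc (1 - z * (t `^ a)%:C))); last by ring.
by rewrite ler_wpM2l// mulr_ge0 ?powR_ge0// addr_ge0// invr_ge0 ltW.
Qed.

(** On ]0, 1[, (1 - t) (1 / (1 - t) + 1 / ln t) = (t - 1 - ln t) / (- ln t). *)
Lemma single_integrandE (z : R[i]) (t : R) : D t ->
  single_integrand a b z t = kernel_integrand z t.
Proof.
rewrite /= in_itv/= => t01; have /andP[t0 t1] := t01.
rewrite /single_integrand mulrAC -rmorphM/=; congr (_%:C / _).
rewrite /log_weight; field.
by rewrite lt_eqF ?ln_lt0// subr_eq0 gt_eqF.
Qed.

End kernel.

(** * Open and connected sets of complex numbers *)

Section topology.
Context {R : realType}.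

Lemma near_normc_lt (z0 : R[i]^o) (e : R) : 0 < e ->
  \forall z \near z0, Normc.normc (z - z0) < e.
Proof.
move=> e0; have e0' : 0 < e%:C :> R[i] by rewrite ltcR.
have /cvgrPdist_lt/(_ _ e0') := @cvg_id _ (nbhs z0).
by apply: filterS => z; rewrite distrC normc_norm ltcR.
Qed.

Lemma open_normc (A : set R[i]^o) :
  (forall z, A z -> exists2 e : R, 0 < e &
    forall z', Normc.normc (z' - z) < e -> A z') -> open A.
Proof.
move=> AP; rewrite openE => z /AP[e e0 eA].
suff : nbhs z A by [].
by apply: filterS (near_normc_lt z _ e0) => z'; exact: eA.
Qed.

(** A star-shaped set is the union of the segments from 0 to its points, which are connected and
    share 0. *)
Lemma connected_star (A : set R[i]^o) :
  (forall z (s : R), 0 <= s <= 1 -> A z -> A (s%:C * z)) -> connected A.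
Proof.
move=> AP.
have -> : A = \bigcup_(z in A) ((fun s : R => s%:C * z : R[i]^o) @` `[0, 1]).
  apply/seteqP; split=> [z Az|_ [z Az [s + <-]]].
    by exists z => //; exists 1; [rewrite /= in_itv/= lexx ler01|rewrite mul1r].
  by rewrite /= in_itv/= => s01; exact: AP.
apply: bigcup_connected.
  exists 0 => z Az; exists 0; first by rewrite /= in_itv/= lexx ler01.
  by rewrite mul0r.
move=> z _; apply: connected_continuous_connected.
  exact: segment_connected.
apply: continuous_subspaceT => s.
apply/cvgrPdist_lt => eps /gt0_complexE[eps0 ->].
(* Adding 1 to |z| keeps the denominator positive when z = 0. *)
have k0 : 0 < complex.Re eps / (Normc.normc z + 1).
  by rewrite divr_gt0// ltr_wpDl// normc_ge0.
have /cvgrPdist_lt/(_ _ k0) := @cvg_id _ (nbhs s).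
apply: filterS => s'; rewrite ltr_pdivlMr ?ltr_wpDl ?normc_ge0// => ss'.
rewrite -mulrBl -rmorphB normc_norm ltcR Normc.normcM normcR.
apply: le_lt_trans ss'; rewrite ler_wpM2l// lerDl//.
Qed.

End topology.

(** * The slit plane and the unit disc *)

Section rays.
Context {R : realType}.
Implicit Types z : R[i].

(** Converse of [off_ray_dist]: at z = t >= 1 the choice w = 1/t makes 1 - z w vanish. *)
Lemma dist_off_ray z (d : R) : 0 < d ->
  (forall w : R, 0 <= w <= 1 -> d <= Normc.normc (1 - z * w%:C)) ->
  ~ (exists2 t : R, 1 <= t & z = t%:C).
Proof.
move=> d0 dP [t t1 zt].
have t0 : 0 < t by exact: lt_le_trans t1.
have := dP t^-1; rewrite invr_ge0 (ltW t0) invf_le1// t1 => /(_ isT).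
have tC : t%:C != 0 :> R[i] by rewrite -normc_gt0 normcR normr_gt0 gt_eqF.
by rewrite zt fmorphV mulfV// subrr Normc.normc0 leNgt d0.
Qed.

Lemma dist_perturb z0 z (d : R) :
  (forall w : R, 0 <= w <= 1 -> d <= Normc.normc (1 - z0 * w%:C)) ->
  Normc.normc (z - z0) <= d / 2 ->
  forall w : R, 0 <= w <= 1 -> d / 2 <= Normc.normc (1 - z * w%:C).
Proof.
move=> dP zz0 w w01; have := dP _ w01; have /andP[w0 w1] := w01.
have := @le_normcD R (1 - z * w%:C) ((z - z0) * w%:C).
rewrite (_ : 1 - _ + _ = 1 - z0 * w%:C); last by ring.
rewrite Normc.normcM normcR ger0_norm//.
have : Normc.normc (z - z0) * w <= d / 2.
  by apply: le_trans zz0; rewrite ler_piMr// normc_ge0.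
lra.
Qed.

Lemma ge1_ray_gt1 z : ~ (exists2 t : R, 1 <= t & z = t%:C) ->
  ~ (exists2 t : R, 1 < t & z = t%:C).
Proof. by move=> h [t t1 zt]; apply: h; exists t => //; exact: ltW. Qed.

Lemma le1_off_open_ray z : Normc.normc z <= 1 ->
  ~ (exists2 t : R, 1 < t & z = t%:C).
Proof.
move=> z1 [t t1 zt]; move: z1; rewrite zt normcR => /(le_trans (ler_norm _)).
by rewrite leNgt t1.
Qed.

(** A positive lower bound [d] for |1 - z w| on [0, 1] characterizes the points off the ray, and
    [d / 2] is still a bound within distance [d / 2]. *)
Lemma open_off_ray :
  open [set z : R[i]^o | ~ (exists2 t : R, 1 <= t & z = t%:C)].
Proof.
apply: open_normc => z /off_ray_dist[d d0 dP]; exists (d / 2).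
  by rewrite divr_gt0.
move=> z' /ltW zz'; apply: (@dist_off_ray _ (d / 2)); first by rewrite divr_gt0.
exact: dist_perturb zz'.
Qed.

(** The set is star-shaped about 0: if s z = t >= 1 with 0 < s <= 1, then z = t / s >= 1. *)
Lemma connected_off_ray :
  connected [set z : R[i]^o | ~ (exists2 t : R, 1 <= t & z = t%:C)].
Proof.
apply: connected_star => z s /andP[s0 s1] zr [t t1 st]; apply: zr.
have t0 : 0 < t by exact: lt_le_trans t1.
have sn0 : s != 0.
  apply: contraTneq t0 => sE; move: st; rewrite sE mul0r => -[<-].
  by rewrite ltxx.
have sp : 0 < s by rewrite lt_neqAle eq_sym sn0.
exists (t / s); first by rewrite ler_pdivlMr// mul1r (le_trans s1).
rewrite rmorphM fmorphV/= -st mulrAC mulfV ?mul1r//.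
by apply: contraNneq sn0 => -[->].
Qed.

Lemma open_unit_disc : open [set z : R[i]^o | `|z| < 1].
Proof.
apply: open_normc => z /=; rewrite normc_norm -[1]/(1%:C) ltcR => z1.
exists (1 - Normc.normc z); first by rewrite subr_gt0.
move=> z' zz'; rewrite normc_norm ltcR.
have := @le_normcD R (z' - z) z; rewrite subrK; lra.
Qed.

End rays.

(** * Power series of the kernel integral *)

Section expansion.
Context {R : realType} (a b : R) (a0 : 0 < a) (b0 : 0 < b).
Notation mu := (@lebesgue_measure R).
Notation D := (`]0, 1[%classic : set R).
Local Notation ker := (kernel_integrand a b).

Lemma kernel_den_gt0 (z : R[i]) (t : R) : 0 < t < 1 ->
  ~ (exists2 t : R, 1 < t & z = t%:C) ->
  0 < Normc.normc (1 - z * (t `^ a)%:C).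
Proof.
move=> t01 /off_open_ray_dist[c c0 cP]; have /andP[w0 w1] := powR01 _ a0 _ t01.
rewrite -(pmulr_rgt0 _ c0); apply: lt_le_trans (cP _ _).
  by rewrite subr_gt0.
by rewrite (ltW w0) (ltW w1).
Qed.

(** Its integral is the n-th Taylor coefficient at [z0] of the kernel integral. *)
Definition expansion_coef (z0 : R[i]) (n : nat) (t : R) : R[i] :=
  (log_weight b t)%:C *
    ((t `^ a)%:C ^+ n / (1 - z0 * (t `^ a)%:C) ^+ n.+1).

Let integrable_scaled_powR (k s : R) : 0 < s ->
  mu.-integrable D (EFin \o (fun t => k * t `^ (s - 1))) /\
  \int[mu]_(t in D) (k * t `^ (s - 1)) = k / s.
Proof.
move=> /integrable_powR[i1 i2]; split; last by rewrite RintegralZl// i2.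
by apply: eq_integrable (integrableZl measurable01 k i1).
Qed.

(** With t^a <= 1 and |1 - z0 t^a| >= d, the integrand is at most d^(-n-1) t^(b-1). *)
Lemma integrable_expansion_coef (z0 : R[i]) (d : R) n : 0 < d ->
  (forall w : R, 0 <= w <= 1 -> d <= Normc.normc (1 - z0 * w%:C)) ->
  integrable01 (expansion_coef z0 n).
Proof.
move=> d0 dP; have [ip _] := integrable_scaled_powR (d^-1 ^+ n.+1) _ b0.
apply: (integrableC_le _ _ measurable01 _ _ _ ip).
  apply: measurable_funCM.
    apply: measurable_funC_real; apply: measurable_funTS.
    exact: measurable_log_weight.
  apply: measurable_funCM.
    apply: measurable_funCX; apply: measurable_funC_real.
    by apply: measurable_funTS; exact: measurable_powR.
  by apply: measurable_funCV; apply: measurable_funCX; exact: measurable_den.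
move=> t; rewrite /= in_itv/= => t01; have /andP[w0 w1] := powR01 _ a0 _ t01.
rewrite !Normc.normcM Normc.normcV !normcX !normcR.
rewrite ger0_norm ?(log_weight_ge0 _ _ a0)// ger0_norm ?(ltW w0)//.
rewrite mulrC; apply: ler_pM; rewrite ?(log_weight_ge0 _ _ a0)//.
- by rewrite mulr_ge0 ?exprn_ge0 ?invr_ge0 ?exprn_ge0 ?normc_ge0// ltW.
- rewrite -exprVn -[leRHS]mul1r; apply: ler_pM.
  + by rewrite exprn_ge0// ltW.
  + by rewrite exprn_ge0// invr_ge0 normc_ge0.
  + by rewrite exprn_ile1// ltW.
  + have dw := dP (t `^ a); rewrite (ltW w0) (ltW w1) in dw.
    have {}dw := dw isT.
    rewrite lerXn2r// ?nnegrE ?invr_ge0 ?normc_ge0 ?(ltW d0)//.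
    by rewrite lef_pV2// posrE// (lt_le_trans d0).
- exact: log_weight_le a0 _ t01.
Qed.

(* [z0 = 0] gives the series of gamma on the closed disc, other [z0] the Taylor
   series of the continuation. *)
Lemma kernel_series (z0 z : R[i]) (d : R) (r : nat -> R -> R) : 0 < d ->
  (forall w : R, 0 <= w <= 1 -> d <= Normc.normc (1 - z0 * w%:C)) ->
  ~ (exists2 t : R, 1 < t & z = t%:C) ->
  (forall n, mu.-integrable D (EFin \o r n)) ->
  (forall n t, 0 < t < 1 -> log_weight b t *
     (Normc.normc ((z - z0) * (t `^ a)%:C / (1 - z0 * (t `^ a)%:C)) ^+ n /
      Normc.normc (1 - z * (t `^ a)%:C)) <= r n t) ->
  \int[mu]_(t in D) r n t @[n --> \oo] --> 0 ->
  series (fun n => integral01 (expansion_coef z0 n) * (z - z0) ^+ n : R[i]^o)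
    @ \oo --> (integral01 (ker z) : R[i]^o).
Proof.
move=> d0 dP zr ri rP r0.
apply: (integralC_series _ _ _ _ measurable01 _ _ _ r) => //.
- exact: integrable_kernel_integrand.
- by move=> n; exact: integrable_expansion_coef dP.
move=> n t; rewrite /= in_itv/= => t01; apply: le_trans (rP n t t01).
have /andP[w0 w1] := powR01 _ a0 _ t01.
have h : 1 - z * (t `^ a)%:C != 0 by rewrite -normc_gt0 kernel_den_gt0.
have h0 : 1 - z0 * (t `^ a)%:C != 0.
  by rewrite -normc_gt0 (lt_le_trans d0)// dP// (ltW w0) (ltW w1).
(* Factoring the weight out of the sum leaves the left side of [geometric_remainder] with w =
   t^a. *)
rewrite /ker (eq_bigr (fun k => (log_weight b t)%:C * ((t `^ a)%:C ^+ k /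
  (1 - z0 * (t `^ a)%:C) ^+ k.+1 * (z - z0) ^+ k))); last first.
  by move=> i _; rewrite mulrA.
rewrite -mulr_sumr -mulrBr geometric_remainder// Normc.normcM normcR.
rewrite ger0_norm ?(log_weight_ge0 _ _ a0)// Normc.normcM normcX Normc.normcV.
exact: lexx.
Qed.

(** At z0 = 0 the integrand is t^(s-1) k(t) with s = a n + b. Writing k(t) = 1 - (1 - t) / (- ln t)
    splits it into the integrals of [integral_powR] and [integral_powR_log]. *)
Lemma kernel_moment n : integral01 (expansion_coef 0 n) =
  ((a * n%:R + b)^-1 - ln ((a * n%:R + b + 1) / (a * n%:R + b)))%:C.
Proof.
set s := a * n%:R + b.
have s0 : 0 < s by rewrite ltr_wpDl// mulr_ge0// ltW.
have [i1 e1] := integrable_powR _ s0.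
pose g t := t `^ (s - 1) * ((1 - t) / - ln t).
have ge0g t : 0 < t < 1 -> 0 <= g t.
  move=> t01; rewrite mulr_ge0 ?powR_ge0// divr_ge0//.
    by rewrite subr_ge0; case/andP: t01 => _ /ltW.
  by rewrite oppr_ge0 ltW// ln_lt0.
have mg : measurable_fun setT g.
  have mln : measurable_fun setT (@ln R) by exact: measurable_ln.
  apply: measurable_funM; first exact: measurable_powR.
  apply: measurable_funM; first exact: measurable_funB.
  by apply: measurable_funV; exact: measurable_funN.
have i2 : mu.-integrable D (EFin \o g).
  apply/integrableP; split.
    by apply/measurable_EFinP; exact: measurable_funTS.
  rewrite (_ : (\int[mu]_(x in D) _)%E = (ln ((s + 1) / s))%:E) ?ltry//.
  rewrite -integral_powR_log//.
  by apply: eq_integral => t /in01 t01; rewrite /= ger0_norm// ge0g.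
have e2 : \int[mu]_(t in D) g t = ln ((s + 1) / s).
  by rewrite /Rintegral integral_powR_log.
rewrite -e2 -e1 -RintegralB//.
have cE t : D t -> expansion_coef 0 n t = (t `^ (s - 1) - g t)%:C.
  rewrite /= in_itv/= => t01; have /andP[t0 t1] := t01.
  rewrite /expansion_coef mul0r subr0 expr1n divr1 -rmorphXn/= -rmorphM/=.
  congr _%:C; rewrite -powR_mulrn ?powR_ge0// -powRrM.
  rewrite /log_weight mulrAC -powRD; last by rewrite (gt_eqF t0) implybT.
  rewrite (_ : b - 1 + a * n%:R = s - 1); last by rewrite /s; ring.
  by rewrite /g; field; rewrite lt_eqF// ln_lt0.
transitivity (integral01 (fun t => (t `^ (s - 1) - g t)%:C)).
  exact: eq_integralC.
rewrite /integral01 /integralC/=; congr Complex.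
by rewrite /Rintegral integral0.
Qed.

Lemma gamma_series (z : R[i]^o) : `|z| <= 1 ->
  series (gamma_term a b z) @ \oo --> (integral01 (ker z) : R[i]^o).
Proof.
rewrite normc_norm -[1]/(1%:C) lecR => z1.
have -> : gamma_term a b z =
    (fun n => integral01 (expansion_coef 0 n) * (z - 0) ^+ n : R[i]^o).
  by apply/funext => n; rewrite kernel_moment subr0.
have zr := le1_off_open_ray _ z1.
have s0 n : 0 < a * n%:R + b by rewrite ltr_wpDl// mulr_ge0// ltW.
(* The weight supplies a factor 1 - t^a <= |1 - z t^a| that cancels the denominator even when |z| =
   1, and (t^a)^n raises the exponent to a n + b - 1. The integral is then (1 + 1/a) / (a n + b),
   which tends to 0. *)
pose r n t := (1 + a^-1) * t `^ (a * n%:R + b - 1).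
apply: (kernel_series 0 z 1 r) => //.
- by move=> w _; rewrite mul0r subr0 Normc.normc1.
- by move=> n; have [] := integrable_scaled_powR (1 + a^-1) _ (s0 n).
- move=> n t t01; have /andP[t0 t1] := t01.
  have /andP[w0 w1] := powR01 _ a0 _ t01.
  rewrite mul0r !subr0 divr1 Normc.normcM normcR (gtr0_norm w0).
  have den0 := kernel_den_gt0 _ _ t01 zr.
  rewrite mulrA ler_pdivrMr//.
  have -> : r n t = (1 + a^-1) * t `^ (b - 1) * (t `^ a) ^+ n.
    rewrite /r -mulrA -powR_mulrn ?powR_ge0// -powRrM -powRD; last first.
      by rewrite (gt_eqF t0) implybT.
    by congr (_ * _ `^ _); ring.
  have dw : 1 - t `^ a <= Normc.normc (1 - z * (t `^ a)%:C).
    apply: onemM_Re_le; first exact: ltW.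
    by apply: le_trans z1; apply: le_trans (abs_Re_le _); exact: ler_norm.
  apply: (@le_trans _ _
    ((1 + a^-1) * t `^ (b - 1) * (1 - t `^ a) * (t `^ a) ^+ n)).
    apply: ler_pM; rewrite ?(log_weight_ge0 _ _ a0)//.
    + by rewrite exprn_ge0// mulr_ge0 ?normc_ge0// ltW.
    + exact: log_weight_le_onem.
    + rewrite lerXn2r ?nnegrE ?mulr_ge0 ?normc_ge0 ?(ltW w0)//.
      by rewrite ger_pMl.
  rewrite mulrAC ler_wpM2l// mulr_ge0 ?exprn_ge0 ?(ltW w0)//.
  by rewrite mulr_ge0 ?powR_ge0// addr_ge0// invr_ge0 ltW.
have -> : (fun n => \int[mu]_(t in D) r n t) =
    (fun n => (1 + a^-1) / (a * n%:R + b)).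
  apply/funext => n.
  by have [_ ->] := integrable_scaled_powR (1 + a^-1) _ (s0 n).
rewrite -[X in _ --> X](mulr0 (1 + a^-1)).
apply: cvgM; first exact: cvg_cst.
apply/gtr0_cvgV0; first exact: nearW.
apply/cvgryPge => A; near=> n.
rewrite -lerBlDr mulrC -ler_pdivrMr//.
near: n; exact: nbhs_infty_ger.
Unshelve. all: by end_near. Qed.

(** If |1 - z0 w| >= d on [0, 1], the expansion converges for |z - z0| < d/2, where the ratio (z -
    z0) w / (1 - z0 w) has modulus at most 1/2. *)
Lemma kernel_analytic (z0 : R[i]^o) :
  ~ (exists2 t : R, 1 <= t & z0 = t%:C) ->
  analytic_at (fun z => integral01 (ker z) : R[i]^o) z0.
Proof.
move=> /off_ray_dist[d d0 dP].
exists (fun n => integral01 (expansion_coef z0 n)).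
have d20 : 0 < d / 2 by rewrite divr_gt0.
apply: filterS (near_normc_lt z0 _ d20) => z /ltW zz0.
have zP := dist_perturb _ _ _ dP zz0.
have zr := ge1_ray_gt1 _ (dist_off_ray _ _ d20 zP).
(* The factor 2/d bounds 1 / |1 - z t^a|, by [dist_perturb], and 2^(-n) bounds the power of the
   ratio. *)
pose r n t := 2 / d * 2^-1 ^+ n * t `^ (b - 1).
apply: (kernel_series z0 z d r) => //.
- by move=> n; have [] := integrable_scaled_powR (2 / d * 2^-1 ^+ n) _ b0.
- move=> n t t01; have /andP[w0 w1] := powR01 _ a0 _ t01.
  have w01 : 0 <= t `^ a <= 1 by rewrite (ltW w0) (ltW w1).
  rewrite mulrC; apply: ler_pM; rewrite ?(log_weight_ge0 _ _ a0)//.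
  + by rewrite divr_ge0 ?exprn_ge0 ?normc_ge0.
  + rewrite mulrC; apply: ler_pM; rewrite ?invr_ge0 ?exprn_ge0 ?normc_ge0//.
      rewrite -invf_div lef_pV2 ?posrE//; first exact: zP.
      exact: lt_le_trans (zP _ w01).
    rewrite lerXn2r ?nnegrE ?invr_ge0 ?normc_ge0//.
    rewrite !Normc.normcM Normc.normcV normcR (gtr0_norm w0).
    have n0 := lt_le_trans d0 (dP _ w01).
    rewrite ler_pdivrMr//.
    have := dP _ w01.
    have : Normc.normc (z - z0) * t `^ a <= d / 2.
      by apply: le_trans zz0; rewrite ler_piMr ?normc_ge0// ltW.
    lra.
  + exact: log_weight_le a0 _ t01.
have -> : (fun n => \int[mu]_(t in D) r n t) =
    (fun n => 2 / d / b * 2^-1 ^+ n).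
  apply/funext => n.
  have [_ ->] := integrable_scaled_powR (2 / d * 2^-1 ^+ n) _ b0.
  by rewrite mulrAC.
rewrite -[X in _ --> X](mulr0 (2 / d / b)).
apply: cvgM; first exact: cvg_cst.
apply: cvg_expr.
by rewrite ger0_norm ?invr_ge0// invf_lt1// ltr1n.
Qed.

End expansion.

(** * The double integral *)

Section double_integral.
Context {R : realType} (a b : R) (a0 : 0 < a) (b0 : 0 < b).
Notation mu := (@lebesgue_measure R).
Notation D := (`]0, 1[%classic : set R).
Local Notation ker := (kernel_integrand a b).

(** The factor of the double integrand that depends on the product x y alone; the remaining factor
    is 1 - x. *)
Definition double_kernel (z : R[i]) (t : R) : R[i] :=
  (t `^ (b - 1) / - ln t)%:C * (1 - z * (t `^ a)%:C)^-1.

Lemma double_integrandE (z : R[i]) (x y : R) : 0 < x < 1 -> 0 < y < 1 ->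
  double_integrand a b z x y = double_kernel z (x * y) * (1 - x)%:C.
Proof.
move=> /andP[x0 _] /andP[y0 _].
rewrite /double_integrand /double_kernel (powRM a (ltW x0) (ltW y0)).
rewrite !rmorphM/= fmorphV/= invfM.
by move: (_^-1) => u; move: (_^-1) => v; ring.
Qed.

Lemma Re_mulR (z : R[i]) (x : R) : complex.Re (z * x%:C) = complex.Re z * x.
Proof. by case: z => p q /=; rewrite mulr0 subr0. Qed.

Lemma Im_mulR (z : R[i]) (x : R) : complex.Im (z * x%:C) = complex.Im z * x.
Proof. by case: z => p q /=; rewrite mulr0 add0r. Qed.

Lemma double_kernelE (z : R[i]) (t : R) :
  double_kernel z t * (t - 1 - ln t)%:C = ker z t.
Proof.
rewrite /double_kernel /kernel_integrand mulrAC -rmorphM/=; congr (_%:C * _).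
by rewrite /log_weight; ring.
Qed.

Lemma measurable_double_kernel (z : R[i]) :
  measurable_funC (R := R) (T := R) setT (double_kernel z).
Proof.
apply: measurable_funCM; last by apply: measurable_funCV; exact: measurable_den.
apply: measurable_funC_real; apply: measurable_funM.
  exact: measurable_powR.
apply: measurable_funV; apply: measurable_funN; exact: measurable_ln.
Qed.

(** For fixed y < 1 the product x y <= y stays away from 1, so neither - ln (x y) nor |1 - z (x
    y)^a| comes near 0, and x^(b-1) dominates up to a constant. *)
Lemma integrable_inner (z : R[i]) (y : R) : 0 < y < 1 ->
  ~ (exists2 t : R, 1 < t & z = t%:C) ->
  integrable01 (fun x => double_kernel z (x * y) * (1 - x)%:C).
Proof.
move=> y01 zr; have /andP[y0 y1] := y01.
have [c c0 cP] := off_open_ray_dist _ zr.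
have [i1 _] := integrable_powR _ b0.
have ly0 : 0 < - ln y by rewrite oppr_gt0 ln_lt0.
have /andP[v0 v1] := powR01 _ a0 _ y01.
(* The factors bound 1 / (- ln (x y)) by its value at x = 1, and 1 / |1 - z (x y)^a| by c / (1 -
   y^a); y^(b-1) is split off from (x y)^(b-1). *)
pose k := y `^ (b - 1) / - ln y * (c / (1 - y `^ a)).
have ik : mu.-integrable D (EFin \o (fun t => k * t `^ (b - 1))).
  by apply: eq_integrable (integrableZl measurable01 k i1).
apply: (integrableC_le _ _ measurable01 _ _ _ ik).
  have mM : measurable_fun D (fun x => x * y) by exact: measurable_funM.
  have [mRe mIm] := measurable_double_kernel z.
  apply: measurable_funCM.
    split.
      exact: (measurableT_comp mRe mM).
    exact: (measurableT_comp mIm mM).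
  by apply: measurable_funC_real; exact: measurable_funB.
move=> x; rewrite /= in_itv/= => x01; have /andP[x0 x1] := x01.
have xy0 : 0 < x * y by exact: mulr_gt0.
have xyy : x * y <= y by rewrite ger_pMl// ltW.
have xy01 : 0 < x * y < 1 by rewrite xy0 (le_lt_trans xyy).
have lxy : - ln y <= - ln (x * y) by rewrite lerN2 ler_ln ?posrE.
have lxy0 : 0 < - ln (x * y) by exact: lt_le_trans lxy.
have vle : (x * y) `^ a <= y `^ a.
  by apply: ge0_ler_powR; rewrite ?nnegrE ?(ltW a0) ?(ltW xy0) ?(ltW y0).
have /andP[w0 w1] := powR01 _ a0 _ xy01.
rewrite 2!Normc.normcM Normc.normcV !normcR.
rewrite (@ger0_norm _ (1 - x)) ?subr_ge0 ?(ltW x1)//.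
have h0 : 0 <= (x * y) `^ (b - 1) / - ln (x * y).
  by apply: divr_ge0; [exact: powR_ge0|exact: ltW].
rewrite (ger0_norm h0).
have n0 := kernel_den_gt0 _ a0 _ _ xy01 zr.
have nV : (Normc.normc (1 - z * ((x * y) `^ a)%:C))^-1 <= c / (1 - y `^ a).
  rewrite -[leRHS]invf_div lef_pV2 ?posrE ?divr_gt0 ?subr_gt0//.
  rewrite ler_pdivrMr// mulrC.
  apply: le_trans (cP _ _); last by rewrite (ltW w0) (ltW w1).
  by rewrite lerB.
rewrite -[leRHS]mulr1; apply: ler_pM.
- by rewrite mulr_ge0// invr_ge0 ltW.
- by rewrite subr_ge0 ltW.
- rewrite (powRM _ (ltW x0) (ltW y0)) /k [leRHS](_ : _ =
    (x `^ (b - 1) * y `^ (b - 1) / - ln y) * (c / (1 - y `^ a))); last by ring.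
  apply: ler_pM => //.
  + by move: h0; rewrite (powRM _ (ltW x0) (ltW y0)).
  + by rewrite invr_ge0 normc_ge0.
  + by rewrite ler_wpM2l ?mulr_ge0 ?powR_ge0// lef_pV2.
- lra.
Qed.

Let double_parts (z : R[i]) : ~ (exists2 t : R, 1 < t & z = t%:C) ->
  mu.-integrable D
    (EFin \o (fun t => complex.Re (double_kernel z t) * (t - 1 - ln t))) /\
  mu.-integrable D
    (EFin \o (fun t => complex.Im (double_kernel z t) * (t - 1 - ln t))).
Proof.
move=> zr; have [ri ji] := integrable_kernel_integrand _ _ a0 b0 _ zr.
split.
  apply: eq_integrable ri => // t _ /=.
  by rewrite -Re_mulR double_kernelE.
apply: eq_integrable ji => // t _ /=.
by rewrite -Im_mulR double_kernelE.
Qed.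

Lemma integrable_double (z : R[i]) : ~ (exists2 t : R, 1 < t & z = t%:C) ->
  integrable0101 (double_integrand a b z).
Proof.
move=> zr; have [mRe mIm] := measurable_double_kernel z.
have [ri ji] := double_parts _ zr.
split.
  split.
    apply: eq_integrable (integrable_mul_square _ mRe ri).
      exact: measurableX.
    move=> [x y] /set_mem[/=]; rewrite !in_itv/= => x01 y01.
    by rewrite double_integrandE// Re_mulR.
  apply: eq_integrable (integrable_mul_square _ mIm ji).
    exact: measurableX.
  move=> [x y] /set_mem[/=]; rewrite !in_itv/= => x01 y01.
  by rewrite double_integrandE// Im_mulR.
move=> y y01; have := integrable_inner _ _ y01 zr.
apply: eq_integrableC; first exact: measurable01.
by move=> x; rewrite /= in_itv/= => x01; rewrite double_integrandE.
Qed.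

(** The factor 1 - x is real, so the real and imaginary parts of [double_kernel] can each play the
    role of [h] in [Rintegral_mul_square]. *)
Lemma integral_double (z : R[i]) : ~ (exists2 t : R, 1 < t & z = t%:C) ->
  integral0101 (double_integrand a b z) = integral01 (ker z).
Proof.
move=> zr; have [mRe mIm] := measurable_double_kernel z.
have [ri ji] := double_parts _ zr.
rewrite /integral0101 /integral01 /integralC/=; congr Complex.
  transitivity (\int[mu]_(t in D)
      (complex.Re (double_kernel z t) * (t - 1 - ln t))).
    rewrite -Rintegral_mul_square//.
      apply: eq_Rintegral => y /in01 y01; apply: eq_Rintegral => x /in01 x01.
      by rewrite double_integrandE// Re_mulR.
    move=> y y01; have [iRe _] := integrable_inner _ _ y01 zr.
    by apply: eq_integrable iRe => // x _ /=; rewrite Re_mulR.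
  by apply: eq_Rintegral => t _; rewrite -Re_mulR double_kernelE.
transitivity (\int[mu]_(t in D)
    (complex.Im (double_kernel z t) * (t - 1 - ln t))).
  rewrite -Rintegral_mul_square//.
    apply: eq_Rintegral => y /in01 y01; apply: eq_Rintegral => x /in01 x01.
    by rewrite double_integrandE// Im_mulR.
  move=> y y01; have [_ iIm] := integrable_inner _ _ y01 zr.
  by apply: eq_integrable iIm => // x _ /=; rewrite Im_mulR.
by apply: eq_Rintegral => t _; rewrite -Im_mulR double_kernelE.
Qed.

Lemma integral_single (z : R[i]) :
  integral01 (single_integrand a b z) = integral01 (ker z).
Proof. by apply: eq_integralC => t; exact: single_integrandE. Qed.

Lemma integrable_single (z : R[i]) : ~ (exists2 t : R, 1 < t & z = t%:C) ->
  integrable01 (single_integrand a b z).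
Proof.
move=> zr; have := integrable_kernel_integrand _ _ a0 b0 _ zr.
apply: eq_integrableC; first exact: measurable01.
by move=> t Dt; rewrite single_integrandE.
Qed.

Lemma gammaE (z : R[i]^o) : `|z| <= 1 -> gamma_ab a b z = integral01 (ker z).
Proof.
by move=> z1; apply: cvg_lim; [exact: norm_hausdorff|exact: gamma_series].
Qed.

(** Stated for any [f] that agrees with the kernel integral off the open ray, so as to serve both
    the double and the single integral. *)
Lemma continuation_kernel (f : R[i]^o -> R[i]^o) :
  (forall z, ~ (exists2 t : R, 1 < t & z = t%:C) -> f z = integral01 (ker z)) ->
  analytic_continuation [set z : R[i]^o | `|z| < 1] (gamma_ab a b)
    [set z : R[i]^o | ~ (exists2 t : R, 1 <= t & z = t%:C)] f.
Proof.
move=> fE; split.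
- by split; [exact: open_unit_disc|exists 0; rewrite /= normr0 ltr01].
- by split; [exact: open_off_ray|exact: connected_off_ray].
- move=> z /= z1 [t t1 zt]; move: z1.
  rewrite normc_norm -[1]/(1%:C) ltcR zt normcR.
  by rewrite ltNge (le_trans t1)// ler_norm.
(* The series at z converges to the kernel integral; as the slit plane is open, [f] agrees with that
   integral throughout a neighbourhood of z. *)
- move=> z zr; have [c cz] := kernel_analytic a b a0 b0 z zr; exists c.
  near=> z'.
  rewrite fE; first by near: z'.
  apply: ge1_ray_gt1; near: z'.
  exact: (open_off_ray z zr).
- move=> z /= z1; rewrite fE; first by rewrite gammaE// ltW.
  apply: le1_off_open_ray; move: z1; rewrite normc_norm -[1]/(1%:C) ltcR.
  exact: ltW.
Unshelve. all: by end_near. Qed.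

End double_integral.

Theorem theorem1 (R : realType) (a b : R) (a_gt0 : 0 < a) (b_gt0 : 0 < b) :
  [/\ (forall z : R[i]^o, `|z| <= 1 ->
         [/\ cvgn (series (gamma_term a b z)),
             gamma_ab a b z = integral0101 (double_integrand a b z) &
             integral0101 (double_integrand a b z) =
             integral01 (single_integrand a b z)]),
      (forall z : R[i]^o, ~ (exists2 t : R, 1 < t & z = t%:C) ->
         integrable0101 (double_integrand a b z) /\
         integrable01 (single_integrand a b z)),
      analytic_continuation [set z : R[i]^o | `|z| < 1] (gamma_ab a b)
        [set z : R[i]^o | ~ (exists2 t : R, 1 <= t & z = t%:C)]
        (fun z => integral0101 (double_integrand a b z)) &
      analytic_continuation [set z : R[i]^o | `|z| < 1] (gamma_ab a b)
        [set z : R[i]^o | ~ (exists2 t : R, 1 <= t & z = t%:C)]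
        (fun z => integral01 (single_integrand a b z))].
Proof.
split.
- move=> z z1.
  have zr : ~ (exists2 t : R, 1 < t & z = t%:C).
    by apply: le1_off_open_ray; move: z1; rewrite normc_norm -[1]/(1%:C) lecR.
  rewrite integral_double// integral_single; split=> //; last exact: gammaE.
  apply/cvg_ex; exists (integral01 (kernel_integrand a b z)).
  exact: gamma_series.
- by move=> z zr; split; [exact: integrable_double|exact: integrable_single].
- by apply: continuation_kernel => // z zr; exact: integral_double.
- by apply: continuation_kernel => // z _; exact: integral_single.
Qed.
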